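(* Let $A$ be a real $m\times n$ matrix and $B$ a real $n\times\rho$ matrix, let $\Theta^{(\kappa)}=\{\Theta^{(\kappa)}_1,\ldots,\Theta^{(\kappa)}_k\}$ be a partition of $\{1,\ldots,n\}$ with $|\Theta^{(\kappa)}|=k$ and $A_{(,\Theta^{(\kappa)}_\ell)}B_{(\Theta^{(\kappa)}_\ell,)}\neq0$ for all $\ell$, and let $p^{(\kappa)}=(p^{(\kappa)}_\ell)_{\ell=1}^k$ be its optimal sampling probability $$p^{(\kappa)}_\ell=\frac{\|A_{(,\Theta^{(\kappa)}_\ell)}B_{(\Theta^{(\kappa)}_\ell,)}\|_F}{\sum_{j=1}^k\|A_{(,\Theta^{(\kappa)}_j)}B_{(\Theta^{(\kappa)}_j,)}\|_F}.$$ For an integer $c\ge1$ let $$\hat S=\frac1c\sum_{i=1}^c\frac1{p^{(\kappa)}_{r_i}}A_{(,\Theta^{(\kappa)}_{r_i})}B_{(\Theta^{(\kappa)}_{r_i},)},$$ where $r_1,\ldots,r_c$ are independent samples from $\{1,\ldots,k\}$ drawn according to $p^{(\kappa)}$. Then $$\|\hat S\|_2\le\|\hat S\|_F\le\sum_{\ell=1}^k\big\|A_{(,\Theta^{(\kappa)}_\ell)}B_{(\Theta^{(\kappa)}_\ell,)}\big\|_F.$$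
   Context: A partition of $\{1,\ldots,n\}$ is into nonempty disjoint blocks $\Theta^{(\kappa)}_\ell$ of indices. $A_{(,\Theta^{(\kappa)}_\ell)}$ is the matrix formed by the columns of $A$ with indices in $\Theta^{(\kappa)}_\ell$, and $B_{(\Theta^{(\kappa)}_\ell,)}$ is the matrix formed by the rows of $B$ with indices in $\Theta^{(\kappa)}_\ell$ (same ordering of indices). A sampling probability has all entries positive and summing to $1$. $\|\cdot\|_F$ is the Frobenius norm and $\|\cdot\|_2$ the spectral norm (operator norm induced by the Euclidean norm). *)

(* Defs.v *)
From mathcomp Require Import all_boot all_order all_algebra.
From mathcomp Require Import all_classical all_reals all_analysis.

Set Implicit Arguments.
Unset Strict Implicit.
Unset Printing Implicit Defensive.

Import Order.TTheory GRing.Theory Num.Theory.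

Local Open Scope classical_set_scope.
Local Open Scope ring_scope.

(* The library's norm on matrices is the max norm, hence these definitions. *)
Definition euclidean_norm (R : realType) (n : nat) (x : 'cV[R]_n) : R :=
  Num.sqrt (\sum_(i < n) x i 0 ^+ 2).

Definition frobenius_norm (R : realType) (m n : nat) (A : 'M[R]_(m, n)) : R :=
  Num.sqrt (\sum_(i < m) \sum_(j < n) A i j ^+ 2).

(* The supremum is over a nonempty bounded set, also when m = 0 or n = 0. *)
Definition spectral_norm (R : realType) (m n : nat) (A : 'M[R]_(m, n)) : R :=
  sup [set euclidean_norm (A *m x) | x in [set x | euclidean_norm x <= 1]].

(* enum_val lists the elements of S in increasing order, so the columns and the
   rows selected below are taken in the same order. *)
Definition col_block (R : realType) (m n : nat) (A : 'M[R]_(m, n))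
    (S : {set 'I_n}) : 'M[R]_(m, #|S|) :=
  colsub (fun j : 'I_#|S| => enum_val j) A.

Definition row_block (R : realType) (n q : nat) (B : 'M[R]_(n, q))
    (S : {set 'I_n}) : 'M[R]_(#|S|, q) :=
  rowsub (fun i : 'I_#|S| => enum_val i) B.

Definition block_prod (R : realType) (m n q : nat)
    (A : 'M[R]_(m, n)) (B : 'M[R]_(n, q)) (S : {set 'I_n}) : 'M[R]_(m, q) :=
  col_block A S *m row_block B S.

(* Injectivity makes the number of blocks equal to k; partition asks the blocks
   to be nonempty, disjoint and to cover all indices. *)
Definition partition_family (n k : nat) (Theta : 'I_k -> {set 'I_n}) : Prop :=
  injective Theta /\
  finset.partition (Theta @: predT) [set: 'I_n].

Definition optimal_prob (R : realType) (m n q k : nat)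
    (A : 'M[R]_(m, n)) (B : 'M[R]_(n, q)) (Theta : 'I_k -> {set 'I_n})
    (l : 'I_k) : R :=
  frobenius_norm (block_prod A B (Theta l)) /
  \sum_(j < k) frobenius_norm (block_prod A B (Theta j)).

(* 'I_k carries the discrete sigma-algebra; independence is the product rule
   over every finite subfamily. *)
Definition independent_samples (R : realType) (d : measure_display)
    (T : measurableType d) (P : probability T R) (c k : nat)
    (p : 'I_k -> R) (r : 'I_c -> T -> 'I_k) : Prop :=
  [/\ forall (i : 'I_c) (E : set 'I_k), measurable (r i @^-1` E),
      forall (J : {set 'I_c}) (E : 'I_c -> set 'I_k),
        P (\bigcap_(i in [set` J]) (r i @^-1` E i)) =
        (\prod_(i in J) P (r i @^-1` E i))%E
    & forall (i : 'I_c) (l : 'I_k), P (r i @^-1` [set l]) = (p l)%:E].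

Definition sampled_prod (R : realType) (m n q k c : nat)
    (A : 'M[R]_(m, n)) (B : 'M[R]_(n, q)) (Theta : 'I_k -> {set 'I_n})
    (p : 'I_k -> R) (s : 'I_c -> 'I_k) : 'M[R]_(m, q) :=
  c%:R^-1 *: \sum_(i < c) (p (s i))^-1 *: block_prod A B (Theta (s i)).

(* Main.v *)
Require Import Defs.
From mathcomp Require Import all_boot all_order all_algebra.
From mathcomp Require Import all_classical all_reals all_analysis.
From mathcomp Require Import ring.

(** Both inequalities are deterministic: they hold for every choice of sampled
    blocks, hence at every sample point.

    The optimal probabilities are proportional to the Frobenius norms of the
    block products, so dividing a block product by its own probability gives a
    matrix of Frobenius norm exactly [\sum_l ||A_l B_l||_F], whichever block it
    is ([frobenius_norm_rescaled_block]). The estimator is an average of such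
    matrices, and the triangle inequality bounds the norm of the average by this
    common value.

    The spectral norm is below the Frobenius norm because, by Cauchy-Schwarz
    applied to each row, [||M x|| <= ||M||_F ||x||]
    ([euclidean_norm_mulmx_le]). The triangle inequality for the Frobenius norm
    comes from the same Cauchy-Schwarz inequality, on the sum over all
    entries. *)

Local Open Scope ring_scope.

Import Order.TTheory GRing.Theory Num.Theory.

(** Lagrange's identity: the defect in Cauchy-Schwarz is half of
    [\sum_(i, j) (u i * v j - u j * v i) ^+ 2]. *)
Lemma cauchy_schwarz_sum {R : realType} {I : finType} (u v : I -> R) :
  (\sum_i u i * v i) ^+ 2 <= (\sum_i u i ^+ 2) * (\sum_i v i ^+ 2).
Proof.
have defect_ge0 : 0 <= \sum_i \sum_j (u i * v j - u j * v i) ^+ 2.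
  by apply: sumr_ge0 => i _; apply: sumr_ge0 => j _; apply: sqr_ge0.
have lagrange : \sum_i \sum_j (u i * v j - u j * v i) ^+ 2 =
    ((\sum_i u i ^+ 2) * (\sum_i v i ^+ 2) - (\sum_i u i * v i) ^+ 2) *+ 2.
  have expand i j : (u i * v j - u j * v i) ^+ 2 =
      u i ^+ 2 * v j ^+ 2 + v i ^+ 2 * u j ^+ 2
      - (u i * v i) * (u j * v j) *+ 2 by ring.
  under eq_bigr => i _ do
    (under eq_bigr => j _ do rewrite expand;
     rewrite sumrB big_split /= sumrMnl -!mulr_sumr).
  rewrite sumrB big_split /= sumrMnl -!mulr_suml; ring.
by move: defect_ge0; rewrite lagrange pmulrn_lge0 // subr_ge0.
Qed.

Lemma sqrt_sum_sqr_triangle {R : realType} {I : finType} (u v : I -> R) :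
  Num.sqrt (\sum_i (u i + v i) ^+ 2) <=
  Num.sqrt (\sum_i u i ^+ 2) + Num.sqrt (\sum_i v i ^+ 2).
Proof.
have sum_sqr_ge0 (f : I -> R) : 0 <= \sum_i f i ^+ 2.
  by apply: sumr_ge0 => i _; apply: sqr_ge0.
have dot_le : \sum_i u i * v i <=
    Num.sqrt (\sum_i u i ^+ 2) * Num.sqrt (\sum_i v i ^+ 2).
  rewrite -sqrtrM //; apply: (le_trans (ler_norm _)).
  by rewrite -sqrtr_sqr ler_wsqrtr // cauchy_schwarz_sum.
rewrite -ler_sqr ?nnegrE ?addr_ge0 ?sqrtr_ge0 //.
rewrite sqrrD !sqr_sqrtr //.
under eq_bigr do rewrite sqrrD.
rewrite 2!big_split /= sumrMnl.
by rewrite lerD2r lerD2l lerMn2r dot_le.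
Qed.

Lemma frobenius_norm_ge0 {R : realType} {m n : nat} (M : 'M[R]_(m, n)) :
  0 <= frobenius_norm M.
Proof. exact: sqrtr_ge0. Qed.

Lemma frobenius_norm0 {R : realType} {m n : nat} :
  frobenius_norm (0 : 'M[R]_(m, n)) = 0.
Proof.
rewrite /frobenius_norm big1 ?sqrtr0 // => i _.
by rewrite big1 // => j _; rewrite mxE expr0n.
Qed.

Lemma frobenius_norm_gt0 {R : realType} {m n : nat} (M : 'M[R]_(m, n)) :
  M != 0 -> 0 < frobenius_norm M.
Proof.
move=> M_neq0; rewrite sqrtr_gt0 lt0r sumr_ge0 ?andbT; last first.
  by move=> i _; apply: sumr_ge0 => j _; apply: sqr_ge0.
apply: contra_neq M_neq0 => sum0; apply/matrixP => i j; rewrite mxE.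
have row0 : \sum_j M i j ^+ 2 = 0.
  apply: (psumr_eq0P _ sum0) => // l _.
  by apply: sumr_ge0 => j' _; apply: sqr_ge0.
apply/eqP; rewrite -sqrf_eq0; apply/eqP.
by apply: (psumr_eq0P _ row0) => // j' _; apply: sqr_ge0.
Qed.

Lemma frobenius_normZ {R : realType} {m n : nat} (a : R) (M : 'M[R]_(m, n)) :
  frobenius_norm (a *: M) = `|a| * frobenius_norm M.
Proof.
rewrite -sqrtr_sqr /frobenius_norm -sqrtrM ?sqr_ge0 // mulr_sumr.
congr Num.sqrt; apply: eq_bigr => i _; rewrite mulr_sumr.
by apply: eq_bigr => j _; rewrite mxE exprMn.
Qed.

Lemma frobenius_norm_triangle {R : realType} {m n : nat} (M N : 'M[R]_(m, n)) :
  frobenius_norm (M + N) <= frobenius_norm M + frobenius_norm N.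
Proof.
rewrite /frobenius_norm !pair_bigA /=.
under eq_bigr do rewrite mxE.
exact: (sqrt_sum_sqr_triangle (fun ij => M ij.1 ij.2) (fun ij => N ij.1 ij.2)).
Qed.

Lemma frobenius_norm_sum {R : realType} {m n : nat} {I : finType}
    (F : I -> 'M[R]_(m, n)) :
  frobenius_norm (\sum_i F i) <= \sum_i frobenius_norm (F i).
Proof.
elim/big_rec2: _ => [|i b M _ le_Mb]; first by rewrite frobenius_norm0.
by apply: (le_trans (frobenius_norm_triangle _ _)); rewrite lerD2l.
Qed.

(** Each coordinate of [M *m x] is the inner product of a row of [M] with
    [x]. *)
Lemma euclidean_norm_mulmx_le {R : realType} {m n : nat}
    (M : 'M[R]_(m, n)) (x : 'cV[R]_n) :
  euclidean_norm (M *m x) <= frobenius_norm M * euclidean_norm x.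
Proof.
rewrite -sqrtrM; last first.
  by apply: sumr_ge0 => i _; apply: sumr_ge0 => j _; apply: sqr_ge0.
apply: ler_wsqrtr; rewrite mulr_suml; apply: ler_sum => i _.
by rewrite mxE cauchy_schwarz_sum.
Qed.

Lemma spectral_norm_le_frobenius_norm {R : realType} {m n : nat}
    (M : 'M[R]_(m, n)) :
  spectral_norm M <= frobenius_norm M.
Proof.
apply: ge_sup.
  (* The zero vector shows that the unit ball is nonempty. *)
  exists (euclidean_norm (M *m 0)), 0 => //=.
  rewrite /euclidean_norm big1 ?sqrtr0 // => i _.
  by rewrite mxE expr0n.
move=> _ [x /= x_le1 <-]; apply: (le_trans (euclidean_norm_mulmx_le M x)).
by rewrite ler_piMr ?frobenius_norm_ge0.
Qed.

(** The optimal probability of a block is its norm over the total, so the norm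
    of the block cancels. *)
Lemma frobenius_norm_rescaled_block {R : realType} {m n q k : nat}
    (A : 'M[R]_(m, n)) (B : 'M[R]_(n, q)) (Theta : 'I_k -> {set 'I_n})
    (l : 'I_k) :
  block_prod A B (Theta l) != 0 ->
  frobenius_norm ((optimal_prob A B Theta l)^-1 *: block_prod A B (Theta l)) =
  \sum_(j < k) frobenius_norm (block_prod A B (Theta j)).
Proof.
move=> /frobenius_norm_gt0 norm_gt0.
have total_ge0 : 0 <= \sum_(j < k) frobenius_norm (block_prod A B (Theta j)).
  by apply: sumr_ge0 => j _; apply: frobenius_norm_ge0.
rewrite frobenius_normZ /optimal_prob invf_div.
by rewrite ger0_norm ?divr_ge0 ?frobenius_norm_ge0 // divfK // gt_eqF.
Qed.

Lemma frobenius_norm_sampled_prod_le {R : realType} {m n q k c : nat}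
    (A : 'M[R]_(m, n)) (B : 'M[R]_(n, q)) (Theta : 'I_k -> {set 'I_n})
    (s : 'I_c -> 'I_k) :
  (forall i, block_prod A B (Theta (s i)) != 0) -> (0 < c)%N ->
  frobenius_norm (sampled_prod A B Theta (optimal_prob A B Theta) s) <=
  \sum_(l < k) frobenius_norm (block_prod A B (Theta l)).
Proof.
move=> block_neq0 c_gt0; rewrite frobenius_normZ ger0_norm ?invr_ge0 //.
rewrite ler_pdivrMl ?ltr0n //; apply: (le_trans (frobenius_norm_sum _)).
under eq_bigr => i _ do rewrite frobenius_norm_rescaled_block //.
by rewrite sumr_const card_ord mulr_natl.
Qed.

Theorem proposition2p8 (R : realType) (m n q k c : nat)
    (A : 'M[R]_(m, n)) (B : 'M[R]_(n, q))
    (Theta : 'I_k -> {set 'I_n})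
    (hTheta : partition_family Theta)
    (hAB : forall l : 'I_k, block_prod A B (Theta l) != 0)
    (hc : (1 <= c)%N)
    (d : measure_display) (T : measurableType d) (P : probability T R)
    (r : 'I_c -> T -> 'I_k)
    (hr : independent_samples P (optimal_prob A B Theta) r)
    (w : T) :
  let S := sampled_prod A B Theta (optimal_prob A B Theta)
             (fun i : 'I_c => r i w) in
  spectral_norm S <= frobenius_norm S /\
  frobenius_norm S <= \sum_(l < k) frobenius_norm (block_prod A B (Theta l)).
Proof.
split; first exact: spectral_norm_le_frobenius_norm.
exact: frobenius_norm_sampled_prod_le.
Qed.
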